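(* Let $r \geq 1$ be an integer, let $\epsilon > 0$, and let $(E,G)$ be an $\epsilon$-uniform rank-$r$ binary representation. Let $\alpha = \frac{|E|}{2^r}$ and let $T_E$ be the number of ordered triples $(x,y,z)$ of elements of $E$ that form a triangle in $G$ (i.e. $x,y,z$ are the three points of a line of $G$). Then $$\left| T_E - \alpha^3 2^{2r} \right| \leq \epsilon\left(\alpha - \alpha^2\right) 2^{2r}.$$
   Context: A rank-$r$ binary representation is an ordered pair $(E,G)$ where $G \cong \mathrm{PG}(r-1,2)$ and $E$ is a subset of the points of $G$. For $\epsilon > 0$, $(E,G)$ is $\epsilon$-uniform if for every hyperplane $H$ of $G$, $$\tfrac{1}{2}\left(|E| - \epsilon 2^r\right) \leq |E \cap H| \leq \tfrac{1}{2}\left(|E| + \epsilon 2^r\right).$$ *)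

(* Defs.v *)
From HB Require Import structures.
From mathcomp Require Import all_boot all_order all_algebra.

Set Implicit Arguments.
Unset Strict Implicit.
Unset Printing Implicit Defensive.

Import Order.TTheory GRing.Theory Num.Theory.
Local Open Scope ring_scope.

Record matroid := Matroid {
  point :> finType;
  rk : {set point} -> nat;
  rk_card : forall X, (rk X <= #|X|)%N;
  rk_mono : forall X Y : {set point}, X \subset Y -> (rk X <= rk Y)%N;
  rk_submod : forall X Y, (rk (X :|: Y) + rk (X :&: Y) <= rk X + rk Y)%N
}.

Definition matroid_iso (M N : matroid) : Prop :=
  exists2 f : M -> N, bijective f & forall X : {set M}, rk (f @: X) = rk X.

Definition is_flat (M : matroid) (F : {set M}) : bool :=
  [forall x, (x \notin F) ==> (rk F < rk (x |: F))%N].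

Definition is_line (M : matroid) (L : {set M}) : bool :=
  is_flat L && (rk L == 2)%N.

Definition is_hyperplane (M : matroid) (H : {set M}) : bool :=
  is_flat H && ((rk H).+1 == rk [set: M])%N.

Definition is_triangle (M : matroid) (x y z : M) : bool :=
  uniq [:: x; y; z] && is_line [set x; y; z].

(* A 1-dimensional subspace over F_2 has exactly one nonzero vector, so the
   points of PG(r-1,2) are represented by the nonzero vectors of F_2^r. *)
Definition pg_point (r : nat) : finType := {v : 'rV['F_2]_r | v != 0}.

Definition pg_span (r : nat) (X : {set pg_point r}) : {vspace 'rV['F_2]_r} :=
  <<[seq val v | v <- enum X]>>%VS.

Definition pg_rk (r : nat) (X : {set pg_point r}) : nat := \dim (pg_span X).

Lemma pg_rk_card r (X : {set pg_point r}) : (pg_rk X <= #|X|)%N.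
Proof. by rewrite cardE -(size_map val); apply: dim_span. Qed.

Lemma pg_spanS r (X Y : {set pg_point r}) :
  X \subset Y -> (pg_span X <= pg_span Y)%VS.
Proof.
move=> /subsetP sXY; apply: sub_span => _ /mapP[v vX ->].
by apply: map_f; move: vX; rewrite !mem_enum; apply: sXY.
Qed.

Lemma pg_rk_mono r (X Y : {set pg_point r}) :
  X \subset Y -> (pg_rk X <= pg_rk Y)%N.
Proof. by move=> sXY; apply/dimvS/pg_spanS. Qed.

Lemma pg_rk_submod r (X Y : {set pg_point r}) :
  (pg_rk (X :|: Y) + pg_rk (X :&: Y) <= pg_rk X + pg_rk Y)%N.
Proof.
rewrite /pg_rk -(dimv_sum_cap (pg_span X)); apply: leq_add; apply: dimvS.
  rewrite /pg_span -span_cat -map_cat; apply: sub_span => _ /mapP[v vXY ->].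
  by apply: map_f; move: vXY; rewrite mem_cat !mem_enum in_setU.
by rewrite subv_cap !pg_spanS ?subsetIl ?subsetIr.
Qed.

(* PG r is the geometry usually written PG(r-1,2): the index is the rank. *)
Definition PG (r : nat) : matroid :=
  Matroid (@pg_rk_card r) (@pg_rk_mono r) (@pg_rk_submod r).

Record binary_rep (r : nat) := BinaryRep {
  geom : matroid;
  geom_iso : matroid_iso geom (PG r);
  elts : {set geom}
}.

Definition uniform (R : realFieldType) (eps : R) (r : nat)
    (B : binary_rep r) : Prop :=
  forall H : {set geom B}, is_hyperplane H ->
    2^-1 * (#|elts B|%:R - eps * 2 ^+ r) <= #|elts B :&: H|%:R
      <= 2^-1 * (#|elts B|%:R + eps * 2 ^+ r).

Definition density (R : realFieldType) (r : nat) (B : binary_rep r) : R :=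
  #|elts B|%:R / 2 ^+ r.

Definition triangle_count (r : nat) (B : binary_rep r) : nat :=
  #|[set t : geom B * geom B * geom B |
      [&& t.1.1 \in elts B, t.1.2 \in elts B, t.2 \in elts B
        & is_triangle t.1.1 t.1.2 t.2]]|.

(* Main.v *)
(** Write N = 2^r, view E as a set A of nonzero vectors of F_2^r, and let h(u)
    be the sum of (-1)^(v.u) over v in A.  Uniformity says |h(u)| <= eps N for
    u <> 0, since h(u) = 2|A :&: u^perp| - |A|.  Three points form a triangle
    exactly when their sum is 0, so N T_E is the sum of all h(u)^3.  The term
    u = 0 is |A|^3, and the remaining terms are at most eps N times the sum of
    h(u)^2 over u <> 0, which by Parseval is N |A| - |A|^2. *)
Require Import Defs.
From mathcomp Require Import all_boot all_order all_algebra.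
From mathcomp Require Import ring lra.

Set Implicit Arguments.
Unset Strict Implicit.
Unset Printing Implicit Defensive.

Import Order.TTheory GRing.Theory Num.Theory.
Local Open Scope ring_scope.

Lemma F2_eq01 (a : 'F_2) : a = 0 \/ a = 1.
Proof. by case: a => [[|[|m]] lt_m] //; [left | right]; apply/val_inj. Qed.

Lemma addvv_F2 r (v : 'rV['F_2]_r) : v + v = 0.
Proof.
by apply/rowP=> i; rewrite !mxE; case: (F2_eq01 (v 0 i)) => ->; apply/val_inj.
Qed.

Lemma addv_eq0_F2 r (v w : 'rV['F_2]_r) : (v + w == 0) = (v == w).
Proof. by rewrite -(inj_eq (addIr w)) -addrA addvv_F2 addr0 add0r. Qed.

(** * Fourier analysis on F_2^r *)

Section Fourier.

Variables (R : realFieldType) (r : nat).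
Implicit Types (u v w : 'rV['F_2]_r) (A : {set 'rV['F_2]_r}).

Definition dot v u : 'F_2 := (v *m u^T) 0 0.

(** The nontrivial additive character of F_2. *)
Definition chi (a : 'F_2) : R := if a == 0 then 1 else -1.

Definition fourier A u : R := \sum_(v in A) chi (dot v u).

Lemma dotDl v w u : dot (v + w) u = dot v u + dot w u.
Proof. by rewrite /dot mulmxDl mxE. Qed.

Lemma dotDr v u w : dot v (u + w) = dot v u + dot v w.
Proof. by rewrite /dot linearD mulmxDr mxE. Qed.

Lemma dot0l u : dot 0 u = 0.
Proof. by rewrite /dot mul0mx mxE. Qed.

Lemma dot0r v : dot v 0 = 0.
Proof. by rewrite /dot trmx0 mulmx0 mxE. Qed.

Lemma dot_delta v i : dot v (delta_mx 0 i) = v 0 i.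
Proof. by rewrite /dot trmx_delta -colE mxE. Qed.

Lemma chiD a b : chi (a + b) = chi a * chi b.
Proof.
by case: (F2_eq01 a) => ->; case: (F2_eq01 b) => ->; rewrite /chi /=;
   rewrite ?mulrNN ?mulr1 ?mul1r.
Qed.

(** Orthogonality of characters: if [v] has a nonzero coordinate [i], translating [u] by the [i]-th
    unit vector flips every sign, so the sum equals its own negative. *)
Lemma sum_chi_dot v : \sum_u chi (dot v u) = if v == 0 then 2 ^+ r else 0.
Proof.
case: eqVneq => [->|/rV0Pn[i vi_neq0]].
  under eq_bigr do rewrite dot0l /chi eqxx.
  by rewrite sumr_const card_mx card_Fp // mul1n natrX.
set S := \sum_u _; suff: S = - S by move=> ?; lra.
rewrite /S {1}(reindex_inj (addIr (delta_mx 0 i))) /= -sumrN.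
apply: eq_bigr => u _; rewrite dotDr chiD dot_delta {2}/chi (negPf vi_neq0).
by rewrite mulrN1.
Qed.

Lemma fourier0 A : fourier A 0 = #|A|%:R.
Proof.
rewrite /fourier; under eq_bigr do rewrite dot0r /chi eqxx.
by rewrite sumr_const.
Qed.

Lemma fourierE A u :
  fourier A u = 2 * #|[set v in A | dot v u == 0]|%:R - #|A|%:R.
Proof.
rewrite -!sum1_card !natr_sum mulr_sumr /fourier.
rewrite [X in _ = X - _](eq_bigl (fun v => (v \in A) && (dot v u == 0))).
  rewrite big_mkcondr -sumrB /=; apply: eq_bigr => v _.
  by rewrite /chi; case: ifP => _; ring.
by move=> v; rewrite inE.
Qed.

Lemma sum_fourier2 A : \sum_u fourier A u ^+ 2 = 2 ^+ r * #|A|%:R.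
Proof.
under eq_bigr do rewrite expr2 /fourier big_distrlr /=.
rewrite exchange_big /= -sum1_card natr_sum mulr_sumr; apply: eq_bigr => v vA.
(* By orthogonality the sum over [u] vanishes unless [v + w = 0], which in characteristic 2 leaves
   only the diagonal [w = v]. *)
rewrite exchange_big (bigD1 v) //=.
rewrite [X in _ + X]big1 => [|w /andP[_ wNv]].
  rewrite addr0; under eq_bigr do rewrite -chiD -dotDl.
  by rewrite sum_chi_dot addvv_F2 eqxx mulr1.
under eq_bigr do rewrite -chiD -dotDl.
by rewrite sum_chi_dot addv_eq0_F2 eq_sym (negPf wNv).
Qed.

(** Distinctness is not imposed: two equal entries would force the third to be 0, and the set used
    in the theorem consists of nonzero vectors. *)
Definition zero_sum_triples A :=
  [set t : 'rV['F_2]_r * 'rV['F_2]_r * 'rV['F_2]_r |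
    [&& t.1.1 \in A, t.1.2 \in A, t.2 \in A & t.1.1 + t.1.2 + t.2 == 0]].

Lemma sum_fourier3 A :
  \sum_u fourier A u ^+ 3 = 2 ^+ r * #|zero_sum_triples A|%:R.
Proof.
have -> : #|zero_sum_triples A|%:R = \sum_(v in A) \sum_(w in A) \sum_(x in A)
    (if v + w + x == 0 then 1 else 0 : R).
  rewrite pair_big pair_big /= -sum1_card natr_sum -big_mkcondr /=.
  by apply: eq_bigl => -[[v w] x]; rewrite inE /= !andbA.
have expand u : fourier A u ^+ 3 = \sum_(v in A) \sum_(w in A) \sum_(x in A)
    chi (dot (v + w + x) u).
  rewrite !exprS expr0 mulr1 /fourier big_distrlr /= mulr_suml.
  apply: eq_bigr => v _; rewrite mulr_sumr; apply: eq_bigr => w _.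
  rewrite !mulr_sumr; apply: eq_bigr => x _.
  by rewrite !dotDl !chiD mulrA.
under eq_bigr do rewrite expand.
rewrite exchange_big mulr_sumr; apply: eq_bigr => v _.
rewrite exchange_big mulr_sumr; apply: eq_bigr => w _.
rewrite exchange_big mulr_sumr; apply: eq_bigr => x _.
by rewrite sum_chi_dot; case: ifP => _; rewrite ?mulr1 ?mulr0.
Qed.

Lemma zero_sum_triples_bound A (eps : R) :
    (forall u, u != 0 -> `|fourier A u| <= eps * 2 ^+ r) ->
  `|2 ^+ r * #|zero_sum_triples A|%:R - #|A|%:R ^+ 3|
    <= eps * 2 ^+ r * (2 ^+ r * #|A|%:R - #|A|%:R ^+ 2).
Proof.
move=> le_eps; rewrite -sum_fourier2 -sum_fourier3 -fourier0.
(* On each side the term at [u = 0] cancels the subtracted power of [#|A|]. *)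
rewrite (bigD1 0) // [in leRHS](bigD1 0) //= ![_ + \sum_(i | _) _]addrC !addrK.
apply: le_trans (ler_norm_sum _ _ _) _; rewrite mulr_sumr.
apply: ler_sum => u u0; rewrite exprS normrM normrX real_normK ?num_real //.
by rewrite ler_wpM2r ?sqr_ge0 ?le_eps.
Qed.

End Fourier.

(** * Flats, hyperplanes and triangles of PG(r-1,2) in terms of subspaces *)

Section ProjectiveGeometry.

Variable r : nat.
Implicit Types (X : {set PG r}) (x y z p : PG r) (U : {vspace 'rV['F_2]_r}).

Lemma mem_pg_span X x : x \in X -> val x \in pg_span X.
Proof. by move=> xX; rewrite memv_span // map_f // mem_enum. Qed.

Lemma pg_span_leP X U :
  reflect (forall x, x \in X -> val x \in U) (pg_span X <= U)%VS.
Proof.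
apply: (iffP span_subvP) => [sXU x xX | sXU _ /mapP[x xX ->]].
  by apply: sXU; rewrite map_f // mem_enum.
by apply: sXU; rewrite -mem_enum.
Qed.

(** Adding a point of the span leaves the rank unchanged; conversely, if adding [p] does not raise
    the rank, the two nested spans have equal dimension and so coincide. *)
Lemma pg_flatP X :
  reflect (forall p, val p \in pg_span X -> p \in X) (is_flat X).
Proof.
have spanU p : (pg_span X <= pg_span (p |: X))%VS by rewrite pg_spanS ?subsetUr.
apply: (iffP forallP) => [flatX p pX | closedX p].
  apply: contraTT (flatX p) => pNX; rewrite pNX /= -leqNgt; apply: dimvS.
  apply/pg_span_leP => x; rewrite in_setU1 => /predU1P[->|] //.
  exact: mem_pg_span.
apply/implyP; apply: contraR; rewrite -leqNgt => le_rk; apply: closedX.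
have /eqP -> : pg_span X == pg_span (p |: X) by rewrite eqEdim spanU.
by rewrite mem_pg_span ?setU11.
Qed.

Definition pg_points U : {set PG r} := [set p : PG r | val p \in U].

Lemma pg_span_points U : pg_span (pg_points U) = U.
Proof.
apply/eqP; rewrite eqEsubv; apply/andP; split.
  by apply/pg_span_leP => x; rewrite inE.
apply/subvP => v vU; have [->|v0] := eqVneq v 0; first exact: mem0v.
pose p : PG r := Sub v v0.
by rewrite -[v]/(val p) mem_pg_span // inE.
Qed.

Lemma is_flat_pg_points U : is_flat (pg_points U).
Proof. by apply/pg_flatP => p; rewrite pg_span_points inE. Qed.

Definition orthogonal u : {vspace 'rV['F_2]_r} :=
  lker (linfun (mulmxr (u : 'rV['F_2]_r)^T)).

Lemma mem_orthogonal u v : (v \in orthogonal u) = (dot v u == 0).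
Proof.
rewrite memv_ker lfunE /= /dot; apply/eqP/eqP => [->|vu]; first by rewrite mxE.
by apply/rowP => i; rewrite ord1 vu mxE.
Qed.

(** Rank-nullity for the functional [v |-> v u^T]: its image is a line, since the unit vector at a
    nonzero coordinate of [u] is not sent to 0. *)
Lemma dim_orthogonal u : u != 0 -> (\dim (orthogonal u)).+1 = r.
Proof.
move=> /rV0Pn[i ui].
rewrite /orthogonal; set f := linfun _.
have := limg_ker_dim f fullv.
rewrite capfv dimvf /dim /= mul1n => dimE; apply: etrans dimE.
suff -> : \dim (limg f) = 1%N by rewrite addn1.
apply/eqP; rewrite eqn_leq (leq_trans (dimvS (subvf _))) ?dimvf //=.
rewrite lt0n dimv_eq0; apply: contra ui => /eqP img0.
have := memv_img f (memvf (delta_mx 0 i)).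
rewrite img0 memv0 lfunE /= => /eqP/rowP/(_ 0).
by rewrite -rowE !mxE => ->.
Qed.

Lemma is_hyperplane_orthogonal u :
  u != 0 -> is_hyperplane (pg_points (orthogonal u)).
Proof.
move=> u0; rewrite /is_hyperplane is_flat_pg_points /= /pg_rk pg_span_points.
have -> : [set: PG r] = pg_points fullv by apply/setP=> p; rewrite !inE memvf.
by rewrite pg_span_points dim_orthogonal // dimvf /dim /= mul1n.
Qed.

Lemma pg_eqE x y : (x == y) = (val x == val y).
Proof. by []. Qed.

(** On a line, [x + y] is a point of the span different from [x] and [y], so flatness forces it to
    be [z]. Conversely, if [z = x + y], the plane spanned by [x] and [y] has only the nonzero
    vectors [x], [y], [x + y]. *)
Lemma pg_triangleE x y z : is_triangle x y z = (val x + val y + val z == 0).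
Proof.
have memS : [/\ x \in [set x; y; z], y \in [set x; y; z] & z \in [set x; y; z]].
  by rewrite !inE !eqxx !orbT.
case: memS => xS yS zS; rewrite addv_eq0_F2.
apply/idP/eqP => [/and3P[uniq_xyz /pg_flatP flat_xyz _] | xy_z].
  have xy0 : val x + val y != 0.
    by move: uniq_xyz; rewrite addv_eq0_F2 /= inE negb_or => /andP[/andP[]].
  pose p : PG r := Sub (val x + val y) xy0.
  have pE : val p = val x + val y by [].
  have: p \in [set x; y; z] by apply: flat_xyz; rewrite pE rpredD ?mem_pg_span.
  rewrite !inE -orbA => /or3P[] /eqP p_eq; move: pE; rewrite p_eq //.
    move/eqP; rewrite -[X in X == _]addr0 (inj_eq (addrI _)).
    by rewrite eq_sym (negPf (valP y)).
  move/eqP; rewrite -[X in X == _]add0r (inj_eq (addIr _)).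
  by rewrite eq_sym (negPf (valP x)).
have xNy : x != y by rewrite pg_eqE -addv_eq0_F2 xy_z (valP z).
have spanE : pg_span [set x; y; z] = (<[val x]> + <[val y]>)%VS.
  apply/eqP; rewrite eqEsubv; apply/andP; split.
    apply/pg_span_leP => p; rewrite !inE => /orP[/orP[]|] /eqP ->.
    - by rewrite (subvP (addvSl _ _)) ?memv_line.
    - by rewrite (subvP (addvSr _ _)) ?memv_line.
    by rewrite -xy_z memv_add ?memv_line.
  by rewrite subv_add -!memvE !mem_pg_span.
apply/and3P; split.
- rewrite /= !inE negb_or xNy !pg_eqE -xy_z /=.
  rewrite -[X in X != _]addr0 (inj_eq (addrI _)) eq_sym (valP y) andbT.
  by rewrite -[X in X != _]add0r (inj_eq (addIr _)) eq_sym (valP x).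
(* The coefficients [a], [b] lie in F_2, and [a = b = 0] is excluded because a point is a nonzero
   vector. *)
- apply/pg_flatP => p; rewrite spanE.
  case/memv_addP => _ /vlineP[a ->] [_ /vlineP[b ->]].
  move=> p_ab; have := valP p; rewrite !inE !pg_eqE p_ab -xy_z.
  by case: (F2_eq01 a) => ->; case: (F2_eq01 b) => ->;
     rewrite ?scale0r ?scale1r ?addr0 ?add0r !eqxx ?orbT.
rewrite /= /pg_rk spanE dimv_disjoint_sum ?dim_vline ?(valP x) ?(valP y) //.
(* Rank 2 needs the two lines to meet trivially; a common nonzero vector would give [x = y]. *)
apply/eqP; rewrite -subv0; apply/subvP => v /memv_capP[].
move=> /vlineP[a ->] /vlineP[b].
case: (F2_eq01 a) => ->; rewrite ?scale0r ?mem0v // scale1r.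
case: (F2_eq01 b) => ->; rewrite ?scale0r ?scale1r.
  by move=> ->; rewrite mem0v.
by move/val_inj=> xy; rewrite xy eqxx in xNy.
Qed.

End ProjectiveGeometry.

(** * Invariance under matroid isomorphism *)

Section Isomorphism.

Variables (M N : matroid) (f : M -> N).
Hypotheses (f_bij : bijective f).
Hypotheses (rk_f : forall X : {set M}, rk (f @: X) = rk X).
Let f_inj : injective f := bij_inj f_bij.

Lemma is_flat_imset (X : {set M}) : is_flat (f @: X) = is_flat X.
Proof.
have [g fK gK] := f_bij.
apply/forallP/forallP => [flatX x | flatX y].
  by have := flatX (f x); rewrite mem_imset // -imsetU1 !rk_f.
by rewrite -[y]gK mem_imset // -imsetU1 !rk_f.
Qed.

Lemma is_hyperplane_imset (X : {set M}) :
  is_hyperplane (f @: X) = is_hyperplane X.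
Proof.
have [g fK gK] := f_bij.
rewrite /is_hyperplane is_flat_imset -!rk_f; congr (_ && (_ == rk _)).
by apply/setP => y; rewrite inE -[y]gK mem_imset ?inE.
Qed.

Lemma is_triangle_iso (x y z : M) :
  is_triangle (f x) (f y) (f z) = is_triangle x y z.
Proof.
rewrite /is_triangle /is_line -[[:: f x; _; _]]/(map f [:: x; y; z]).
by rewrite map_inj_uniq // -!imset_set1 -!imsetU is_flat_imset rk_f.
Qed.

End Isomorphism.

(** * Transfer of the Fourier bound to an arbitrary representation *)

Theorem theorem3p1 (R : realFieldType) (r : nat) (eps : R) (B : binary_rep r)
    (hr : (1 <= r)%N) (heps : 0 < eps) (hB : uniform eps B) :
  let alpha : R := density R B in
  `|(triangle_count B)%:R - alpha ^+ 3 * 2 ^+ (2 * r)|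
    <= eps * (alpha - alpha ^+ 2) * 2 ^+ (2 * r).
Proof.
cbv zeta; have [f f_bij rk_f] := geom_iso B.
have f_inj := bij_inj f_bij; have [g fK gK] := f_bij.
pose phi (x : geom B) : 'rV['F_2]_r := val (f x).
have phi_inj : injective phi by move=> x y /val_inj/f_inj.
pose A := phi @: elts B.
have cardA : #|A| = #|elts B| by rewrite card_imset.
have triangles : triangle_count B = #|zero_sum_triples A|.
  pose phi3 (t : geom B * geom B * geom B) := (phi t.1.1, phi t.1.2, phi t.2).
  have phi3_inj : injective phi3.
    by move=> [[x y] z] [[x' y'] z'] [/phi_inj-> /phi_inj-> /phi_inj->].
  rewrite /triangle_count -(card_imset _ phi3_inj); apply: eq_card => -[[u v] w].
  rewrite inE /=; apply/imsetP/and4P => [[[[x y] z]] |].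
    rewrite inE /= => /and4P[xE yE zE xyz] [-> -> ->].
    by rewrite !imset_f // -pg_triangleE (is_triangle_iso f_bij rk_f).
  case=> /imsetP[x xE ->] /imsetP[y yE ->] /imsetP[z zE ->] xyz.
  exists (x, y, z) => //; rewrite inE /= xE yE zE.
  by rewrite -(is_triangle_iso f_bij rk_f) pg_triangleE.
have fourier_le u : u != 0 -> `|fourier R A u| <= eps * 2 ^+ r.
  (* Uniformity is assumed in [geom B], so the hyperplane orthogonal to [u] is pulled back along
     [f]. *)
  move=> u0; pose H := f @^-1: pg_points (orthogonal u).
  have fH : f @: H = pg_points (orthogonal u).
    by apply/setP => y; rewrite -[y]gK mem_imset // inE.
  have hypH : is_hyperplane H.
    by rewrite -(is_hyperplane_imset f_bij rk_f) fH is_hyperplane_orthogonal.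
  have cardH : #|[set v in A | dot v u == 0]| = #|elts B :&: H|.
    rewrite -(card_imset _ phi_inj); apply: eq_card => v; rewrite inE.
    apply/andP/imsetP => [[/imsetP[x xE ->] xu] | [x]].
      by exists x; rewrite // !inE xE mem_orthogonal.
    by rewrite !inE mem_orthogonal => /andP[xE xu] ->; rewrite imset_f.
  rewrite fourierE cardH cardA ler_norml.
  by case/andP: (hB _ hypH) => ? ?; apply/andP; split; lra.
have N_gt0 : 0 < 2 ^+ r :> R by rewrite exprn_gt0.
have := zero_sum_triples_bound fourier_le; rewrite -triangles cardA.
rewrite /density mulnC exprM.
set N : R := 2 ^+ r in N_gt0 *; set n : R := #|elts B|%:R; set T := _%:R.
have N0 : N != 0 by rewrite gt_eqF.
(* The Fourier bound is [N] times the desired one; both sides are written as quotients by [N]. *)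
have -> : T - (n / N) ^+ 3 * N ^+ 2 = (N * T - n ^+ 3) / N by field.
have -> : eps * (n / N - (n / N) ^+ 2) * N ^+ 2 = eps * N * (N * n - n ^+ 2) / N.
  by field.
by rewrite normrM normfV (gtr0_norm N_gt0) ler_pM2r ?invr_gt0.
Qed.
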